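(* Let $X$ be a regular curve and let $f: X\to X$ be a monotone map. Then the map $\omega_f: X\to 2^X$, $x\mapsto\omega_f(x)$, is continuous at every point of $X\setminus\mathrm{P}(f)$, and the map $\alpha_f: X_\infty\to 2^X$, $x\mapsto\alpha_f(x)$, is continuous at every point of $X_\infty\setminus\mathrm{P}(f)$.
   Context: A continuum is a compact connected metric space. A regular curve is a continuum $X$ such that for each $x\in X$ and each open neighborhood $V$ of $x$ there is an open neighborhood $U$ of $x$, $U\subset V$, whose boundary $\partial U$ is finite. A continuous map $f:X\to Y$ is monotone if $f^{-1}(C)$ is connected for every connected subset $C$ of $Y$ (the empty set counts as connected; $f$ need not be onto). $X_\infty=\bigcap_{n\in\mathbb{N}}f^n(X)$, with the subspace topology. $2^X$ is the set of non-empty compact subsets of $X$ with the Hausdorff metric. The $\omega$-limit set of $x$ is $\omega_f(x)=\bigcap_{n\in\mathbb{N}}\overline{\{f^k(x):k\ge n\}}$. The $\alpha$-limit set of $x$ is $\alpha_f(x)=\bigcap_{k\ge 0}\overline{\bigcup_{n\ge k}f^{-n}(x)}$, where $f^{-n}(x)=(f^n)^{-1}(\{x\})$; it is non-empty and closed for $x\in X_\infty$. $\mathrm{P}(f)$ is the set of periodic points ($f^n(x)=x$ for some $n\ge1$). *)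

(* Defs.v *)
From HB Require Import structures.
From mathcomp Require Import all_boot all_order all_algebra.
From mathcomp Require Import all_classical all_reals all_analysis.

Set Implicit Arguments.
Unset Strict Implicit.
Unset Printing Implicit Defensive.

Import Order.TTheory GRing.Theory Num.Theory.

Local Open Scope classical_set_scope.
Local Open Scope ring_scope.

Definition boundary (T : topologicalType) (A : set T) : set T :=
  closure A `\` interior A.

(* The empty space is not excluded; nothing is claimed about its points. *)
Definition continuum (R : realType) (X : metricType R) : Prop :=
  compact [set: X] /\ connected [set: X].

Definition regular_curve (R : realType) (X : metricType R) : Prop :=
  continuum X /\
  forall (x : X) (V : set X), open V -> V x ->
    exists U : set X, [/\ open U, U x, U `<=` V & finite_set (boundary U)].

Definition monotone_map (T U : topologicalType) (f : T -> U) : Prop :=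
  continuous f /\
  forall C : set U, connected C -> connected (f @^-1` C).

Definition X_infty (T : Type) (f : T -> T) : set T :=
  \bigcap_n (iter n f @` [set: T]).

Definition periodic_points (T : Type) (f : T -> T) : set T :=
  [set x | exists n, (0 < n)%N /\ iter n f x = x].

Definition omega_limit (T : topologicalType) (f : T -> T) (x : T) : set T :=
  \bigcap_n closure [set iter k f x | k in [set k | (n <= k)%N]].

Definition alpha_limit (T : topologicalType) (f : T -> T) (x : T) : set T :=
  \bigcap_k closure
    (\bigcup_(n in [set n | (k <= n)%N]) (iter n f @^-1` [set x])).

Record hyperspace (T : topologicalType) : Type := Hyperspace {
  hset :> set T;
  hset_compact : compact hset;
  hset_neq0 : hset !=set0 }.

HB.instance Definition _ (T : topologicalType) := gen_eqMixin (hyperspace T).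
HB.instance Definition _ (T : topologicalType) :=
  gen_choiceMixin (hyperspace T).

Lemma hset_inj (T : topologicalType) (A B : hyperspace T) :
  hset A = hset B -> A = B.
Proof.
case: A B => [A cA A0] [B cB B0] /= AB; subst B.
by rewrite (Prop_irrelevance cA cB) (Prop_irrelevance A0 B0).
Qed.

Definition dist_to (R : realType) (X : metricType R) (a : X) (B : set X) : R :=
  inf [set mdist a b | b in B].

Definition hausdorff_dist (R : realType) (X : metricType R) (A B : set X) : R :=
  Num.max (sup [set dist_to a B | a in A]) (sup [set dist_to b A | b in B]).

Section hausdorff_metric.
Context {R : realType} {X : metricType R}.
Implicit Types (A B C : hyperspace X) (a b c : X) (e : R).

Lemma dist_to_le a b B : hset B b -> dist_to a B <= mdist a b.
Proof.
move=> Bb; apply: ge_inf; last by exists b.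
by exists 0 => _ [y _ <-]; exact: mdist_ge0.
Qed.

Lemma le_dist_to a B e :
  (forall b, hset B b -> e <= mdist a b) -> e <= dist_to a B.
Proof.
move=> h; apply: lb_le_inf; last by move=> _ [b Bb <-]; exact: h.
by have [b Bb] := hset_neq0 B; exists (mdist a b); exists b.
Qed.

Lemma dist_to_ge0 a B : 0 <= dist_to a B.
Proof. by apply: le_dist_to => b _; exact: mdist_ge0. Qed.

Lemma dist_to_in a B : hset B a -> dist_to a B = 0.
Proof.
move=> Ba; apply/eqP; rewrite eq_le dist_to_ge0 andbT.
by rewrite -(mdistxx a); exact: dist_to_le.
Qed.

Lemma dist_to_eq0 a B : dist_to a B = 0 -> hset B a.
Proof.
have cB := compact_closed (@metric_hausdorff _ X) (@hset_compact _ B).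
move=> aB0; apply: cB.
move=> N; rewrite -metricType_numDomainType.nbhs_nbhs_mdist => -[e /= e0 eN].
apply: contrapT => BN.
have : e <= dist_to a B.
  apply: le_dist_to => b Bb; rewrite leNgt; apply/negP => abe.
  by apply: BN; exists b; split => //; exact: eN.
by rewrite aB0 leNgt e0.
Qed.

Lemma hyperspace_bounded A b : exists M, forall a, hset A a -> mdist b a <= M.
Proof.
have /compact_near_coveringP cA : compact (hset A) by exact: hset_compact.
have [|N _ AN] := cA nat \oo (fun n a => mdist b a <= n%:R) _; last first.
  by exists N%:R => a Aa; exact: (AN N (leqnn N) a Aa).
move=> x _; exists (ball x 1, [set n | (Num.truncn (mdist b x + 1) < n)%N]).
  by split; [exact: nbhsx_ballx|exists (Num.truncn (mdist b x + 1)).+1].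
move=> [y n] [/=]; rewrite ballEmdist /= => xy nx.
apply: le_trans (metric_triangle b x y) _.
apply: (@le_trans _ _ (mdist b x + 1)); first by rewrite lerD2l ltW.
by apply/ltW/(lt_le_trans (truncnS_gt _)); rewrite ler_nat.
Qed.

Lemma dist_to_bounded A B :
  has_ubound [set dist_to a B | a in A].
Proof.
have [b Bb] := hset_neq0 B; have [M AM] := hyperspace_bounded A b.
exists M => _ [a Aa <-]; apply: le_trans (AM a Aa).
by rewrite metric_sym; exact: dist_to_le.
Qed.

Lemma hausdorff_dist_sym A B : hausdorff_dist A B = hausdorff_dist B A.
Proof. by rewrite /hausdorff_dist maxC. Qed.

Lemma dist_to_le_hausdorff a A B : hset A a -> dist_to a B <= hausdorff_dist A B.
Proof.
move=> Aa; rewrite /hausdorff_dist le_max; apply/orP; left.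
by apply: ub_le_sup; [exact: dist_to_bounded|exists a].
Qed.

Lemma hausdorff_dist_le A B e :
  (forall a, hset A a -> dist_to a B <= e) -> (forall b, hset B b -> dist_to b A <= e) ->
  hausdorff_dist A B <= e.
Proof.
move=> AB BA; rewrite /hausdorff_dist ge_max; apply/andP; split; apply: ge_sup.
- by have [a Aa] := hset_neq0 A; exists (dist_to a B); exists a.
- by move=> _ [a Aa <-]; exact: AB.
- by have [b Bb] := hset_neq0 B; exists (dist_to b A); exists b.
- by move=> _ [b Bb <-]; exact: BA.
Qed.

Lemma hausdorff_distxx A : hausdorff_dist A A = 0.
Proof.
apply/eqP; rewrite eq_le; apply/andP; split.
  by apply: hausdorff_dist_le => a Aa; rewrite dist_to_in.
have [a Aa] := hset_neq0 A.
exact: le_trans (dist_to_ge0 a A) (dist_to_le_hausdorff A Aa).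
Qed.

Lemma hausdorff_dist_positivity A B : hausdorff_dist A B = 0 -> A = B.
Proof.
move=> AB0; apply: hset_inj; apply/seteqP; split=> x Hx; apply: dist_to_eq0;
  apply/eqP; rewrite eq_le dist_to_ge0 andbT -AB0; last rewrite hausdorff_dist_sym;
  exact: dist_to_le_hausdorff.
Qed.

Lemma dist_to_triangle a B C : dist_to a C <= dist_to a B + hausdorff_dist B C.
Proof.
rewrite -lerBlDr; apply: le_dist_to => b Bb; rewrite lerBlDr.
apply: (@le_trans _ _ (mdist a b + dist_to b C)); last first.
  by rewrite lerD2l; exact: dist_to_le_hausdorff.
rewrite -lerBlDl; apply: le_dist_to => c Cc; rewrite lerBlDl.
by apply: le_trans (dist_to_le a Cc) _; exact: metric_triangle.
Qed.

Lemma hausdorff_dist_triangle B A C :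
  hausdorff_dist A C <= hausdorff_dist A B + hausdorff_dist B C.
Proof.
apply: hausdorff_dist_le => x Hx.
  by apply: le_trans (dist_to_triangle x B C) _; rewrite lerD2r dist_to_le_hausdorff.
apply: le_trans (dist_to_triangle x B A) _.
by rewrite addrC (hausdorff_dist_sym B A) lerD2l (hausdorff_dist_sym B C)
  dist_to_le_hausdorff.
Qed.

HB.instance Definition _ := @isMetric.Build R (hyperspace X)
  (fun A B => hausdorff_dist A B) hausdorff_distxx hausdorff_dist_positivity
  hausdorff_dist_sym hausdorff_dist_triangle.

End hausdorff_metric.

Section limit_sets.
Context {T : topologicalType} (cT : compact [set: T]).

Lemma bigcap_closure_compact (A : nat -> set T) :
  compact (\bigcap_n closure (A n)).
Proof.
apply: (subclosed_compact _ cT) => //.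
by apply: closed_bigI => n _; exact: closed_closure.
Qed.

Lemma bigcap_closure_neq0 (A : nat -> set T) :
  (forall n, A n !=set0) -> (forall m n, (m <= n)%N -> A n `<=` A m) ->
  \bigcap_n closure (A n) !=set0.
Proof.
move=> A0 Adec; pose F : set_system T := filter_from setT A.
have FF : ProperFilter F.
  apply: filter_from_proper => //; apply: filter_from_filter; first by exists 0%N.
  move=> m n _ _; exists (maxn m n) => // x Ax.
  by split; apply: Adec Ax; rewrite ?leq_maxl ?leq_maxr.
have [|p [_ Fp]] := @cT F FF; first by exists 0%N.
exists p => n _ B pB; apply: Fp => //; by exists n.
Qed.

Lemma omega_limit_neq0 (f : T -> T) (x : T) : omega_limit f x !=set0.
Proof.
apply: bigcap_closure_neq0 => [n|m n mn]; first by exists (iter n f x), n => /=.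
by move=> _ [k nk <-]; exists k => //=; exact: leq_trans nk.
Qed.

Lemma alpha_limit_neq0 (f : T -> T) (x : T) :
  X_infty f x -> alpha_limit f x !=set0.
Proof.
move=> xf; apply: bigcap_closure_neq0 => [n|m n mn].
  by have [y _ yx] := xf n I; exists y, n => /=.
by move=> y [k nk yx]; exists k => //=; exact: leq_trans nk.
Qed.

Definition omega_map (f : T -> T) (x : T) : hyperspace T :=
  Hyperspace (@bigcap_closure_compact _) (omega_limit_neq0 f x).

Definition alpha_map (f : T -> T) (x : X_infty f) : hyperspace T :=
  Hyperspace (@bigcap_closure_compact _) (alpha_limit_neq0 (set_valP x)).

End limit_sets.

Arguments alpha_map {T} cT f x.

Lemma regular_curve_compact (R : realType) (X : metricType R) :
  regular_curve X -> compact [set: X].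
Proof. by case=> -[]. Qed.

(* Main.v *)
Require Import Defs.
From mathcomp Require Import all_boot all_order all_algebra.
From mathcomp Require Import all_classical all_reals all_analysis.
From mathcomp Require Import lra zify.

(** Why the theorem is true.

    The only property of regular curves that matters, besides local connectedness,
    is [cutting_set]: for each [d > 0] there is a finite set [F] that meets every
    connected set of diameter at least [d]. Images and preimages of connected sets
    under the iterates of [f] are connected, so whenever many of them are large,
    two of them share a point [v] of [F], by the pigeonhole principle.

    Let [y] be a point that is not periodic, and [B] a small connected set near
    [y]. If [f^-i B] and [f^-j B] share a point [v] then [B] contains two points of
    the orbit of [v], which is impossible for bounded [j - i] as [f^(j-i) y] is not
    [y]. Thus all but a bounded number of the sets [f^-i B] in any window of times
    are small, however long the window ([backward_window]). If [f^i B] and [f^j B]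
    share [v], with [i < j], then [B] and [f^(j-i) B] meet the same fiber [f^-i v].
    Fibers are connected, so those of [v] become small with increasing [i], unless
    [v] is one of finitely many periodic points ([fibers_shrink]); hence the same
    conclusion holds for images at late times ([forward_window]). The exceptional
    periodic points can be avoided by the choice of [F] if [y] is not recurrent, and
    their fibers do not come near [y] if [y] is recurrent
    ([recurrent_off_periodic_basins]).

    Suppose next that the images [f^n B] of ever smaller sets [B] near [y] are large
    at arbitrarily late times [n]. Some [v] in [F] is in infinitely many of them, so
    small fibers [f^-k v] come close to [y], and since [f^(n-k) B] meets [f^-k v] and
    is small for one of finitely many [k], the whole of [f^(n-k) B] is close to [y]
    ([forward_return], [backward_return]). In particular the iterates are
    asymptotically equicontinuous at every point that is neither periodic nor
    recurrent ([nonrecurrent_equicontinuous]).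

    Continuity of [omega] and [alpha] at [y] follows. Let [y'] be near [y] and [B] a
    small connected set containing both. For lower semicontinuity, either [f^n B] is
    small and the orbits of [y] and [y'] are close at time [n], or the orbit of [y']
    comes back to [y] and from there follows the orbit of [y]. For upper
    semicontinuity let [z] be a limit of points of [omega(y')], respectively
    [alpha(y')], as [y'] tends to [y]. The window lemmas imply that [omega(z)] is
    contained in the limit set of [y]. If [z] is not in this limit set then it is not
    recurrent, so the iterates are asymptotically equicontinuous at [z]; but orbits
    of points near [z] return to [z], and thus so does the orbit of [z], which is
    a contradiction. *)

Set Implicit Arguments.
Unset Strict Implicit.
Unset Printing Implicit Defensive.

Import Order.TTheory GRing.Theory Num.Theory.

Local Open Scope classical_set_scope.
Local Open Scope ring_scope.

(** * Finite lists and pigeonholes *)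

Lemma seq_uniform (R : realType) (T : eqType) (s : seq T)
    (Q : T -> R -> nat -> Prop) :
  (forall v b b' l l', 0 < b' -> b' <= b -> (l <= l')%N ->
     Q v b l -> Q v b' l') ->
  (forall v, v \in s -> exists2 b, 0 < b & exists l, Q v b l) ->
  exists2 b, 0 < b & exists l, forall v, v \in s -> Q v b l.
Proof.
move=> Qmono; elim: s => [_|a s IHs Qs]; first by exists 1 => //; exists 0%N.
have [|b b0 [l Ql]] := IHs.
  by move=> v vs; apply: Qs; rewrite inE vs orbT.
have [|c c0 [m Qm]] := Qs a; first by rewrite inE eqxx.
exists (Num.min b c); first by rewrite lt_min b0 c0.
exists (maxn l m) => v; rewrite inE => /orP[/eqP->|vs].
  apply: Qmono Qm; rewrite ?leq_maxr ?ge_min ?lexx ?orbT//.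
  by rewrite lt_min b0 c0.
apply: Qmono (Ql v vs); rewrite ?leq_maxl ?ge_min ?lexx//.
by rewrite lt_min b0 c0.
Qed.

Lemma seq_uniform_gt0 (R : realType) (T : eqType) (s : seq T)
    (Q : T -> R -> Prop) :
  (forall v b b', 0 < b' -> b' <= b -> Q v b -> Q v b') ->
  (forall v, v \in s -> exists2 b, 0 < b & Q v b) ->
  exists2 b, 0 < b & forall v, v \in s -> Q v b.
Proof.
move=> Qm Qs.
have [||b b0 [_ Qb]] := @seq_uniform R T s (fun v b _ => Q v b); last by exists b.
- by move=> v b b' _ _ b'0 b'b _; exact: Qm.
- by move=> v /Qs[b b0 Qb]; exists b => //; exists 0%N.
Qed.

Lemma seq_uniform_nat (T : eqType) (s : seq T) (Q : T -> nat -> Prop) :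
  (forall v l l', (l <= l')%N -> Q v l -> Q v l') ->
  (forall v, v \in s -> exists l, Q v l) ->
  exists l, forall v, v \in s -> Q v l.
Proof.
move=> Qm; elim: s => [_|a s IHs Qs]; first by exists 0%N.
have [|l Ql] := IHs; first by move=> v vs; apply: Qs; rewrite inE vs orbT.
have [|m Qa] := Qs a; first by rewrite inE eqxx.
exists (maxn l m) => v; rewrite inE => /orP[/eqP->|vs].
  by apply: Qm Qa; exact: leq_maxr.
by apply: Qm (Ql v vs); exact: leq_maxl.
Qed.

Lemma frequently_uniq (P : nat -> Prop) (N : nat) :
  (forall L, exists2 n, (L <= n)%N & P n) ->
  exists I : seq nat, [/\ uniq I, size I = N & forall n, n \in I -> P n].
Proof.
move=> Pinf; elim: N => [|N [I [uI sI PI]]]; first by exists [::].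
have [n nI Pn] := Pinf (\max_(i <- I) i).+1.
exists (n :: I); split => /=.
- rewrite uI andbT; apply/negP => nin.
  by by have := @leq_bigmax_seq _ I xpredT id n nin isT; rewrite leqNgt nI.
- by rewrite sI.
- by move=> m; rewrite inE => /orP[/eqP->|/PI].
Qed.

Lemma pigeonhole_rel (T : eqType) (I : seq nat) (F : seq T)
    (h : nat -> T -> Prop) :
  uniq I -> (size F < size I)%N ->
  (forall i, i \in I -> exists2 v, v \in F & h i v) ->
  exists i j v, [/\ i \in I, j \in I, (i < j)%N, v \in F & h i v /\ h j v].
Proof.
move=> uI FI hI.
have [v0 _] : exists v : T, True.
  by case: I uI FI hI => // a I _ _ /(_ a (mem_head _ _))[v]; exists v.
have /choice[g gI] : forall i, exists v, i \in I -> v \in F /\ h i v.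
  move=> i; have [/hI[v vF hv]|nI] := boolP (i \in I); first by exists v.
  by exists v0.
have [ginj|] := pselect {in I &, injective g}.
  have := @uniq_leq_size _ [seq g i | i <- I] F.
  rewrite map_inj_in_uniq// size_map => /(_ uI) IF.
  have /IF : {subset [seq g i | i <- I] <= F}.
    by move=> v /mapP[i iI ->]; have [] := gI i iI.
  by rewrite leqNgt FI.
move=> ninj; apply: contrapT => none; apply: ninj => i j iI jI gij.
have [ij|ij|//] := ltngtP i j; exfalso; apply: none.
- exists i, j, (g i); have [gF hg] := gI i iI; split => //; split => //.
  by rewrite gij; have [] := gI j jI.
- exists j, i, (g i); have [gF hg] := gI i iI; split => //; split => //.
  by rewrite gij; have [] := gI j jI.
Qed.

(** * Metric and topological preliminaries *)

Section metric_preliminaries.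
Context {R : realType} {X : metricType R}.
Implicit Types (A B C U : set X) (x y z u v : X) (e r d : R).

Lemma nbhs_mdist x A : nbhs x A <-> exists2 e, 0 < e & forall u, mdist x u < e -> A u.
Proof.
rewrite -metricType_numDomainType.nbhs_nbhs_mdist; split.
  by move=> [e e0 eA]; exists e.
by move=> [e e0 eA]; exists e.
Qed.

Lemma open_mdistP A : open A <->
  forall x, A x -> exists2 e, 0 < e & forall u, mdist x u < e -> A u.
Proof.
rewrite openE; split=> [oA x /oA/nbhs_mdist//|oA x Ax].
exact/nbhs_mdist/oA.
Qed.

Lemma closure_mdistP A x :
  closure A x <-> forall e, 0 < e -> exists2 a, A a & mdist x a < e.
Proof.
split=> [Ax e e0|Ax B /nbhs_mdist[e e0 eB]].
  have /Ax[a [Aa xa]] : nbhs x [set u | mdist x u < e].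
    by apply/nbhs_mdist; exists e.
  by exists a.
by have [a Aa xa] := Ax e e0; exists a; split => //; exact: eB.
Qed.

Lemma open_mdist_lt x r : open [set u | mdist x u < r].
Proof.
apply/open_mdistP => u /= xu; exists (r - mdist x u); first by rewrite subr_gt0.
move=> w uw; have := metric_triangle x u w; lra.
Qed.

Lemma open_mdist_gt x r : open [set u | r < mdist x u].
Proof.
apply/open_mdistP => u /= xu; exists (mdist x u - r); first by rewrite subr_gt0.
move=> w uw; have := metric_triangle x w u; rewrite (metric_sym w u); lra.
Qed.

Lemma closed_mdist_le x r : closed [set u | mdist x u <= r].
Proof.
rewrite -openC; have := open_mdist_gt x r; congr open.
by apply/seteqP; split => u /=; rewrite ltNge => /negP.
Qed.

Lemma closure_mdist_le x r A :
  (forall a, A a -> mdist x a <= r) -> forall a, closure A a -> mdist x a <= r.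
Proof.
move=> Ar a /(closureS (Ar : A `<=` [set u | mdist x u <= r])).
by rewrite -(closure_id _).1//; exact: closed_mdist_le.
Qed.

(** In terms of [small e A], a family of sets of diameter tending to [0] is one
    that is eventually [small e] for every [e]; the supremum of distances never
    has to be formed. *)
Definition small d A := forall p q, A p -> A q -> mdist p q < d.

Lemma boundaryU A B : boundary (A `|` B) `<=` boundary A `|` boundary B.
Proof.
move=> x [+ nx]; rewrite closureU => -[Ax|Bx]; [left|right]; split => // ix.
- by apply: nx; exact: (interiorS (@subsetUl _ A B)) ix.
- by apply: nx; exact: (interiorS (@subsetUr _ A B)) ix.
Qed.

Lemma open_boundaryE U : open U -> boundary U = closure U `\` U.
Proof. by move=> oU; rewrite /boundary (interior_id _).1. Qed.

Lemma connected_split C U K : connected C -> open U -> closed K ->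
  C `&` U = C `&` K -> C `&` U !=set0 -> C `<=` U.
Proof.
move=> cC oU cK CUK CU0.
have <- : C `&` U = C by apply: cC => //; [exists U | exists K].
exact: subIsetr.
Qed.

Lemma connected_sub_open C U : connected C -> open U -> C `&` U !=set0 ->
  C `&` boundary U = set0 -> C `<=` U.
Proof.
move=> cC oU CU0 Cb; apply: (connected_split (K := closure U)) => //.
  exact: closed_closure.
apply/seteqP; split => x [Cx Ux]; split => //; first exact: subset_closure.
apply: contrapT => nUx; rewrite (_ : False = set0 x)// -Cb; split => //.
by rewrite open_boundaryE.
Qed.

Lemma connected_image C (g : X -> X) : continuous g -> connected C -> connected (g @` C).
Proof.
by move=> cg cC; apply: connected_continuous_connected => //; apply: continuous_subspaceT.
Qed.

(** * Cluster points of sequences of sets *)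

(** The topological upper limit of the sequence [G]. Both [omega_limit] and
    [alpha_limit] are of this form: [G n] is [{f^n x}] for the first and [f^-n x]
    for the second. *)
Definition cluster_set (G : nat -> set X) z :=
  forall e L, 0 < e -> exists n u, [/\ (L <= n)%N, G n u & mdist z u < e].

Lemma cluster_set_closed (G : nat -> set X) z :
  (forall e, 0 < e -> exists2 w, cluster_set G w & mdist z w < e) -> cluster_set G z.
Proof.
move=> Gz e L e0; have [|w Gw zw] := Gz (e / 2); first by rewrite divr_gt0.
have [|n [u [Ln Gu wu]]] := Gw (e / 2) L; first by rewrite divr_gt0.
by exists n, u; split => //; have := metric_triangle z w u; lra.
Qed.

Lemma cluster_setP (G : nat -> set X) z : cluster_set G z <->
  (\bigcap_k closure (\bigcup_(n in [set n | (k <= n)%N]) G n)) z.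
Proof.
split=> [Gz k _|Gz e L e0].
  apply/closure_mdistP => e e0; have [n [u [kn Gu zu]]] := Gz e k e0.
  by exists u => //; exists n.
by have /closure_mdistP/(_ e e0)[u [n /= Ln Gu] zu] := Gz L I; exists n, u.
Qed.

End metric_preliminaries.

Section compact_metric.
Context {R : realType} {X : metricType R} (cX : compact [set: X]).

(** The remainders left uncovered by the finite subfamilies form a filter base. *)
Lemma finite_subcover (U : X -> set X) :
  (forall x, nbhs x (U x)) -> exists D : seq X, forall u, exists2 x, x \in D & U x u.
Proof.
move=> nU; apply: contrapT => nfin.
pose rest (D : seq X) := [set u | forall x, x \in D -> ~ U x u].
have FF : ProperFilter (filter_from setT rest).
  apply: filter_from_proper.
    apply: filter_from_filter; first by exists [::].
    move=> D E _ _; exists (D ++ E) => // u uDE; split=> x xD; apply: uDE.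
      by rewrite mem_cat xD.
    by rewrite mem_cat xD orbT.
  move=> D _; apply: contrapT => none; apply: nfin; exists D => u.
  apply: contrapT => nu; apply: none; exists u => x xD Uxu.
  by apply: nu; exists x.
have [|z [_ Fz]] := @cX _ FF; first by exists [::].
have [||w [rw Uw]] := Fz (rest [:: z]) (U z); [by exists [:: z] | exact: nU |].
by apply: rw Uw; rewrite inE.
Qed.

Lemma cluster_set_neq0 (G : nat -> set X) :
  (forall L, exists n u, (L <= n)%N /\ G n u) -> exists z, cluster_set G z.
Proof.
move=> G0.
have [|m n mn|z Gz] := @bigcap_closure_neq0 _ cX
  (fun k => \bigcup_(n in [set n | (k <= n)%N]) G n).
- by move=> k; have [n [u [kn Gu]]] := G0 k; exists u, n.
- by move=> u [k /= nk Gu]; exists k => //=; exact: leq_trans nk.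
- by exists z; apply/cluster_setP.
Qed.

Lemma cluster_set_attracts (G : nat -> set X) (e : R) : 0 < e ->
  exists L, forall n u, (L <= n)%N -> G n u ->
    exists2 z, cluster_set G z & mdist z u < e.
Proof.
move=> e0; apply: contrapT => far.
have [|z Gz] := @cluster_set_neq0
  (fun n => [set u | G n u /\ forall w, cluster_set G w -> e <= mdist w u]).
  move=> L; apply: contrapT => none; apply: far; exists L => n u Ln Gu.
  apply: contrapT => nz; apply: none; exists n, u; split => //; split => // w Gw.
  by rewrite leNgt; apply/negP => wu; apply: nz; exists w.
have Gz' : cluster_set G z.
  by move=> r L r0; have [n [u [Ln [Gu _] zu]]] := Gz r L r0; exists n, u.
have [n [u [_ [_ /(_ z Gz')]]]] := Gz e 0%N e0.
by rewrite leNgt => /negP.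
Qed.

Lemma invn_le_truncn (b : R) (n : nat) :
  0 < b -> (Num.truncn b^-1 <= n)%N -> n.+1%:R^-1 <= b.
Proof.
move=> b0 bn; rewrite invf_ple ?posrE ?ltr0n//; apply: ltW.
by apply: lt_le_trans (truncnS_gt _) _; rewrite ler_nat ltnS.
Qed.

(** A property with a scale [e] that holds near each point at some scale holds
    everywhere at a common one. *)
Lemma compact_uniform (Q : X -> R -> Prop) :
  (forall z e e', 0 < e' -> e' <= e -> Q z e -> Q z e') ->
  (forall z, exists r e, [/\ 0 < r, 0 < e &
     forall w, mdist z w < r -> Q w e]) ->
  exists2 e, 0 < e & forall z, Q z e.
Proof.
move=> Qmono Qloc; apply: contrapT => none.
have [|z Gz] := @cluster_set_neq0 (fun n => [set w | ~ Q w n.+1%:R^-1]).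
  move=> L; apply: contrapT => all; apply: none; exists L.+1%:R^-1.
    by rewrite invr_gt0.
  by move=> z; apply: contrapT => nQ; apply: all; exists L, z.
have [r [e [r0 e0 Qz]]] := Qloc z.
have [n [w [Ln /= nQ zw]]] := Gz r (Num.truncn e^-1) r0.
apply: nQ; apply: Qmono (Qz w zw); first by rewrite invr_gt0.
exact: invn_le_truncn.
Qed.

End compact_metric.

(** * Regular curves *)

Section regular_curves.
Context {R : realType} {X : metricType R} (hX : regular_curve X).
Implicit Types (A B C U P : set X) (x y z u v : X) (e r d : R).

Lemma regular_nbhd_in x V : open V -> V x ->
  exists U, [/\ open U, U x, U `<=` V & exists F : seq X, boundary U = [set` F]].
Proof.
move=> oV Vx; have [U [oU Ux UV /finite_seqP bU]] := hX.2 x V oV Vx.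
by exists U.
Qed.

Lemma regular_nbhd x r : 0 < r -> exists U,
  [/\ open U, U x, forall u, closure U u -> mdist x u < r
    & exists F : seq X, boundary U = [set` F]].
Proof.
move=> r0.
have [|U [oU Ux Ur bU]] := @regular_nbhd_in x _ (open_mdist_lt x (r / 2)).
  by rewrite /= mdistxx divr_gt0.
exists U; split => // u Uu.
have : mdist x u <= r / 2 by apply: closure_mdist_le Uu => a /Ur/ltW.
lra.
Qed.

Lemma regular_nbhd_seq (O : seq X) V : open V -> (forall v, v \in O -> V v) ->
  exists W, [/\ open W, forall v, v \in O -> W v, W `<=` V
    & exists F : seq X, boundary W `<=` [set` F]].
Proof.
move=> oV; elim: O => [_|a O IHO OV].
  exists set0; split => //; first exact: open0.
  by exists [::] => u; rewrite open_boundaryE ?closure0//; [case|exact: open0].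
have [|W [oW OW WV [F bW]]] := IHO; first by move=> v vO; apply: OV; rewrite inE vO orbT.
have [|U [oU Ua UV [G bU]]] := regular_nbhd_in oV (x := a).
  by apply: OV; rewrite inE eqxx.
exists (U `|` W); split => //.
- exact: openU.
- by move=> v; rewrite inE => /orP[/eqP->|/OW]; [left|right].
- by move=> u [/UV|/WV].
- exists (G ++ F) => u /boundaryU[]; rewrite /= mem_cat.
    by rewrite bU => /= ->.
  by move=> /bW /= ->; rewrite orbT.
Qed.

(** The boundary of a regular neighborhood of [x] never contains [x] itself, so
    a small one avoids any prescribed finite set. *)
Lemma regular_nbhd_avoiding x r (T : seq X) : 0 < r -> exists U,
  [/\ open U, U x, forall u, closure U u -> mdist x u < r
    & exists2 F : seq X, boundary U = [set` F] & forall t, t \in T -> t \notin F].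
Proof.
move=> r0.
have [||b b0 Tb] := @seq_uniform_gt0 R _ T (fun t b => t != x -> b <= mdist x t).
- by move=> t b b' _ b'b /[apply]; exact: le_trans.
- move=> t _; have [->|tx] := eqVneq t x; first by exists 1.
  by exists (mdist x t); rewrite ?mdist_gt0 1?eq_sym.
have [|U [oU Ux Ur [F bU]]] := @regular_nbhd x (Num.min r b).
  by rewrite lt_min r0.
exists U; split => //; first by move=> u /Ur; rewrite lt_min => /andP[].
exists F => // t tT; apply/negP => tF.
have : boundary U t by rewrite bU.
rewrite open_boundaryE// => -[/Ur]; rewrite lt_min => /andP[_ tb] nUt.
have tx : t != x by apply/eqP => tx; apply: nUt; rewrite tx.
by have := Tb t tT tx; rewrite leNgt tb.
Qed.

Definition cuts (F : seq X) d :=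
  forall C, connected C -> (forall v, v \in F -> ~ C v) -> small d C.

(** Cover the compact space by finitely many sets of small diameter with finite
    boundaries: a connected set that avoids all these boundaries lies within a
    single member of the cover. *)
Lemma cutting_set d (T : seq X) : 0 < d ->
  exists2 F : seq X, cuts F d & forall t, t \in T -> t \notin F.
Proof.
move=> d0.
have /choice[U HU] : forall x, exists U : set X, [/\ open U, U x,
    forall u, closure U u -> mdist x u < d / 2
    & exists2 F : seq X, boundary U = [set` F] & forall t, t \in T -> t \notin F].
  by move=> x; apply: regular_nbhd_avoiding; rewrite divr_gt0.
have /choice[F HF] : forall x, exists F : seq X,
    boundary (U x) = [set` F] /\ forall t, t \in T -> t \notin F.
  by move=> x; have [_ _ _ [F]] := HU x; exists F.
have [|D cov] := finite_subcover (regular_curve_compact hX) (U := U).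
  by move=> x; apply: open_nbhs_nbhs; split; have [] := HU x.
exists (flatten [seq F x | x <- D]).
  move=> C cC CF p q Cp Cq.
  have [x xD Uxp] := cov p; have [oU _ Ud _] := HU x.
  have CU : C `<=` U x.
    apply: connected_sub_open => //; first by exists p.
    rewrite (HF x).1; apply/seteqP; split => // v [Cv /= vF].
    by apply: (CF v) => //; apply/flatten_mapP; exists x.
  have xp := Ud p (subset_closure (CU p Cp)).
  have xq := Ud q (subset_closure (CU q Cq)).
  by have := metric_triangle p x q; rewrite (metric_sym p x); lra.
move=> t tT; apply/negP => /flatten_mapP[x _].
by apply/negP; exact: (HF x).2.
Qed.

(** A set that is clopen in [closure U] and misses the boundary of [U] is clopen
    in [X]. *)
Lemma clopen_off_boundary U P z : open U -> ~ P z ->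
  (exists2 V, open V & P = closure U `&` V) ->
  (exists2 K, closed K & P = closure U `&` K) ->
  P `&` boundary U = set0 -> P = set0.
Proof.
move=> oU nPz [V oV PV] [K cK PK] Pb.
apply: contrapT => /eqP/set0P P0; apply: nPz.
suff -> : P = setT by [].
apply: (hX.1.2) => //.
- exists (U `&` V); first exact: openI.
  rewrite setTI; apply/seteqP; split=> u; last first.
    by move=> [Uu Vu]; rewrite PV; split => //; exact: subset_closure.
  move=> Pu; have := Pu; rewrite {1}PV => -[cUu Vu]; split => //.
  apply: contrapT => nUu; rewrite (_ : False = set0 u)// -Pb; split => //.
  by rewrite open_boundaryE.
- exists (closure U `&` K); last by rewrite setTI.
  by apply: closedI => //; exact: closed_closure.
Qed.

(** Regular curves are locally connected. Among the relatively clopen subsets of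
    [closure U] containing [y], one with the fewest points of the finite boundary
    of [U] is contained in all the others: removing one of those from it leaves a
    relatively clopen set that avoids the boundary, hence is empty. *)
Lemma locally_connected y r : 0 < r ->
  exists2 r', 0 < r' & forall z, mdist y z < r' ->
    exists B, [/\ connected B, B y, B z & forall u, B u -> mdist y u < r].
Proof.
move=> r0; have [U [oU Uy Ur [F bU]]] := regular_nbhd y r0.
pose clop P := [/\ P y, exists2 V, open V & P = closure U `&` V
                     & exists2 K, closed K & P = closure U `&` K].
pose cnt P := count (fun v => `[< P v >]) F.
have [P [clP Pmin]] : exists P, clop P /\ forall P', clop P' -> (cnt P <= cnt P')%N.
  have exn : exists n, `[< exists2 P, clop P & cnt P = n >].
    exists (cnt (closure U)); apply/asboolP; exists (closure U) => //; split.
    - exact: subset_closure.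
    - by exists setT; [exact: openT | rewrite setIT].
    - by exists setT; [exact: closedT | rewrite setIT].
  case: (ex_minnP exn) => n /asboolP[P clP <-] nmin.
  by exists P; split => // P' clP'; apply: nmin; apply/asboolP; exists P'.
have [Py [V oV PV] [K cK PK]] := clP.
have cP : connected P.
  suff Psub : forall Q : set X, Q y -> (exists2 W, open W & Q = P `&` W) ->
      (exists2 L, closed L & Q = P `&` L) -> Q = P.
    move=> Q Q0 [W oW QW] [L cL QL].
    have [Qy|nQy] := pselect (Q y); first by apply: Psub => //; [exists W|exists L].
    have QC : P `\` Q = P.
      apply: Psub => //.
      - exists (~` L); first by rewrite openC.
        rewrite QL; apply/seteqP; split => u [Pu nu]; split => // Lu;
          by [apply: nu | case: Lu].
      - exists (~` W); first by rewrite closedC.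
        rewrite QW; apply/seteqP; split => u [Pu nu]; split => // Lu;
          by [apply: nu | case: Lu].
    case: Q0 => q Qq; have : (P `\` Q) q by rewrite QC; rewrite QW in Qq; case: Qq.
    by case.
  move=> Q Qy [W oW QW] [L cL QL].
  have QP : Q `<=` P by rewrite QW => u [].
  have clQ : clop Q.
    split => //; first by exists (V `&` W); [exact: openI|rewrite QW PV setIA].
    by exists (K `&` L); [exact: closedI|rewrite QL PK setIA].
  have PQF v : v \in F -> P v -> Q v.
    move=> vF Pv; apply: contrapT => nQv.
    suff : (cnt Q < cnt P)%N by rewrite ltnNge Pmin.
    have cntQ : (cnt Q = count (fun v => `[< P v >]) [seq v <- F | `[< Q v >]])%N.
      rewrite /cnt count_filter; apply: eq_count => w /=.
      apply/asboolP/andP => [Qw|[_ /asboolP//]].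
      by split; apply/asboolP => //; exact: QP.
    have cntP : cnt P = (count (fun v => `[< P v >]) [seq v <- F | `[< Q v >]] +
        count (fun v => `[< P v >]) [seq v <- F | ~~ `[< Q v >]])%N.
      by rewrite -count_cat; apply/permP; rewrite perm_sym; apply/permPl/perm_filterC.
    rewrite cntP cntQ -[X in (X < _)%N]addn0 ltn_add2l -has_count.
    apply/hasP; exists v; last exact/asboolP.
    by rewrite mem_filter vF andbT; apply/asboolPn.
  apply/seteqP; split => // u Pu; apply: contrapT => nQu.
  have : P `\` Q = set0.
    apply: (@clopen_off_boundary U _ y) => //.
    - by case.
    - exists (V `&` ~` L); first by apply: openI => //; rewrite openC.
      rewrite QL PV; apply/seteqP; split => w.
        by move=> [[Uw Vw] nw]; split => //; split => // Lw; apply: nw.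
      by move=> [Uw [Vw nw]]; split => // -[].
    - exists (K `&` ~` W); first by apply: closedI => //; rewrite closedC.
      rewrite QW PK; apply/seteqP; split => w.
        by move=> [[Uw Vw] nw]; split => //; split => // Lw; apply: nw.
      by move=> [Uw [Vw nw]]; split => // -[].
    - rewrite bU; apply/seteqP; split => // w [[Pw nQw] wF]; exfalso.
      by apply: nQw; exact: PQF.
  by move=> /seteqP[/(_ u) + _]; apply.
have [e e0 ePU] : exists2 e, 0 < e & forall u, mdist y u < e -> (U `&` V) u.
  apply: ((open_mdistP _).1 (openI oU oV)).
  by split => //; move: Py; rewrite {1}PV => -[].
exists e => // z /ePU[Uz Vz]; exists P; split => //.
  by rewrite PV; split => //; exact: subset_closure.
by move=> u; rewrite {1}PV => -[/Ur].
Qed.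

End regular_curves.

(** * Orbits *)

Section orbits.
Context {T : eqType} (f : T -> T).

Lemma iter_period p v n : iter p f v = v -> iter n f v = iter (n %% p)%N f v.
Proof.
move=> pv; rewrite {1}(divn_eq n p) addnC iterD; congr iter.
by elim: (n %/ p)%N => // k IHk; rewrite mulSn iterD IHk.
Qed.

Lemma periodic_recur p v n : iter p f v = v -> iter (n * p) f v = v.
Proof. by move=> pv; rewrite (iter_period _ pv) modnMl. Qed.

(** An orbit that meets a periodic point is finite. *)
Lemma periodic_in_orbit w : exists s : seq T,
  forall n, periodic_points f (iter n f w) -> iter n f w \in s.
Proof.
have [[n0 [p [p0 pw]]]|none] := pselect (exists n, periodic_points f (iter n f w)).
  exists [seq iter i f w | i <- iota 0 (n0 + p)] => n _.
  have [nn0|n0n] := ltnP n n0.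
    by apply: map_f; rewrite mem_iota add0n ltn_addr.
  rewrite -(subnK n0n) iterD (iter_period _ pw) -iterD; apply: map_f.
  by rewrite mem_iota add0n leq0n addnC ltn_add2l ltn_mod.
by exists [::] => n pn; exfalso; apply: none; exists n.
Qed.

Lemma nonperiodic_left_once v w n m : ~ periodic_points f v ->
  iter n f w = v -> iter m f w = v -> n = m.
Proof.
move=> nv; wlog nm : n m / (n <= m)%N => [hw|nw mw].
  by have [/hw//|/ltnW/hw h] := leqP n m => nw mw; rewrite (h mw nw).
move: nm; rewrite leq_eqVlt => /orP[/eqP//|nm]; exfalso; apply: nv.
exists (m - n)%N; split; first by rewrite subn_gt0.
by rewrite -[in LHS]nw -iterD subnK// ltnW.
Qed.

(** The exceptional set [S] consists of the periodic points met by the orbits of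
    [F]; an orbit passes at most once through a nonperiodic point. *)
Lemma orbits_leave (F : seq T) : exists2 S : seq T,
  (forall v, v \in S -> periodic_points f v) &
  (forall v, v \notin S ->
     exists L, forall w n, w \in F -> (L <= n)%N -> iter n f w <> v).
Proof.
elim: F => [|a F [S Sp SF]]; first by exists [::] => // v _; exists 0%N.
have [s sa] := periodic_in_orbit a.
exists ([seq v <- s | `[< periodic_points f v >]] ++ S) => v.
  by rewrite mem_cat mem_filter => /orP[/andP[/asboolP]|/Sp].
rewrite mem_cat negb_or mem_filter => /andP[vs /SF[L HL]].
have [M HM] : exists M, forall n, (M <= n)%N -> iter n f a <> v.
  have [[m mv]|none] := pselect (exists m, iter m f a = v); last first.
    by exists 0%N => n _ nv; apply: none; exists n.
  have nv : ~ periodic_points f v.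
    move=> pv; move/negP: vs; apply; apply/andP; split; first exact/asboolP.
    by rewrite -mv; apply: sa; rewrite mv.
  exists m.+1 => n mn nv'; have := nonperiodic_left_once nv mv nv'.
  by move=> mE; rewrite mE ltnn in mn.
exists (maxn L M) => w n; rewrite inE geq_max => /orP[/eqP->|wF] /andP[Ln Mn].
  exact: HM.
exact: HL.
Qed.

End orbits.

Section monotone_dynamics.
Context {R : realType} {X : metricType R} (hX : regular_curve X).
Context (f : X -> X) (hf : monotone_map f).
Implicit Types (A B C U : set X) (x y z u v w a : X) (e r d : R).


Lemma iter_continuous n : continuous (iter n f).
Proof.
elim: n => [|n IHn] x; first exact: cvg_id.
by apply: (@continuous_comp _ _ _ (iter n f) f); [exact: IHn | exact: hf.1].
Qed.

Lemma iter_mdist n x e : 0 < e ->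
  exists2 b, 0 < b & forall u, mdist x u < b -> mdist (iter n f x) (iter n f u) < e.
Proof.
move=> e0; apply/nbhs_mdist.
have := @iter_continuous n x [set v | mdist (iter n f x) v < e]; apply.
by apply/nbhs_mdist; exists e.
Qed.

Lemma iter_mdist_seq (I : seq nat) x e : 0 < e ->
  exists2 b, 0 < b & forall u, mdist x u < b ->
    forall i, i \in I -> mdist (iter i f x) (iter i f u) < e.
Proof.
move=> e0; have [||b b0 bI] := @seq_uniform_gt0 R _ I
  (fun i b => forall u, mdist x u < b -> mdist (iter i f x) (iter i f u) < e).
- by move=> i b b' _ b'b H u ub; apply: H; exact: lt_le_trans b'b.
- by move=> i _; exact: iter_mdist.
- by exists b => // u ub i /bI; exact.
Qed.

Lemma connected_preimage n C : connected C -> connected (iter n f @^-1` C).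
Proof.
elim: n C => // n IHn C cC.
have -> : iter n.+1 f @^-1` C = iter n f @^-1` (f @^-1` C) by [].
by apply: IHn; exact: hf.2.
Qed.

(** * Fibers of the iterates *)

(** The fibers [f^-n v] are connected, so each of them that is not [small e]
    meets a fixed finite set; but the orbits of a finite set visit [v] finitely
    often, unless [v] is one of finitely many periodic points. *)
Lemma fibers_shrink e : 0 < e -> exists2 S : seq X,
  (forall v, v \in S -> periodic_points f v) &
  (forall v, v \notin S ->
     exists L, forall n, (L <= n)%N -> small e (iter n f @^-1` [set v])).
Proof.
move=> e0; have [F cF _] := cutting_set hX [::] e0.
have [S Sp SF] := orbits_leave f F; exists S => // v /SF[L HL].
exists L => n Ln; apply: cF; first exact: connected_preimage (@connected1 _ v).
by move=> w wF /=; exact: HL.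
Qed.

Lemma nonperiodic_fibers_shrink v e : ~ periodic_points f v -> 0 < e ->
  exists L, forall n, (L <= n)%N -> small e (iter n f @^-1` [set v]).
Proof.
move=> nv e0; have [S Sp] := fibers_shrink e0; apply.
by apply/negP => /Sp.
Qed.

Lemma cutting_set_small_fibers d e : 0 < d -> 0 < e ->
  exists2 F : seq X, cuts F d & exists L, forall n v, (L <= n)%N -> v \in F ->
    small e (iter n f @^-1` [set v]).
Proof.
move=> d0 e0; have [S _ HS] := fibers_shrink e0.
have [F cF FS] := cutting_set hX S d0; exists F => //.
have [||L HL] := @seq_uniform_nat _ F (fun v L => forall n, (L <= n)%N ->
    small e (iter n f @^-1` [set v])).
- by move=> v l l' ll' H n l'n; apply: H; exact: leq_trans l'n.
- by move=> v vF; apply: HS; apply/negP => /FS; rewrite vF.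
- by exists L => n v Ln vF; exact: HL.
Qed.

End monotone_dynamics.

(** * Recurrent points and basins of periodic points *)

Section recurrence.
Context {R : realType} {X : metricType R} (hX : regular_curve X).
Context (f : X -> X) (hf : monotone_map f).
Implicit Types (A B C U : set X) (x y z u v w a : X) (e r d b : R) (I : seq nat).

Lemma omega_limitP x z : omega_limit f x z <->
  forall e L, 0 < e -> exists2 n, (L <= n)%N & mdist z (iter n f x) < e.
Proof.
split=> [xz e L e0|xz k _].
  by have /closure_mdistP/(_ e e0)[_ [n /= Ln <-] zn] := xz L I; exists n.
apply/closure_mdistP => e e0; have [n kn zn] := xz e k e0.
by exists (iter n f x) => //; exists n.
Qed.

Lemma alpha_limitP x z : alpha_limit f x z <->
  forall e L, 0 < e -> exists n u, [/\ (L <= n)%N, iter n f u = x & mdist z u < e].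
Proof. by split=> [/(cluster_setP (fun n => iter n f @^-1` [set x]))|xz]; last exact/cluster_setP. Qed.

Lemma nonperiodic_displacement y M : ~ periodic_points f y ->
  exists2 e, 0 < e & forall k, (0 < k <= M)%N -> e <= mdist y (iter k f y).
Proof.
move=> ny.
have [||e e0 He] := @seq_uniform_gt0 R _ (iota 1 M) (fun k e => e <= mdist y (iter k f y)).
- by move=> k e e' _ e'e; exact: le_trans.
- move=> k; rewrite mem_iota => /andP[k0 _]; exists (mdist y (iter k f y)) => //.
  by rewrite mdist_gt0; apply/eqP => yk; apply: ny; exists k.
- by exists e => // k /andP[k0 kM]; apply: He; rewrite mem_iota add1n ltnS k0.
Qed.

Lemma nonrecurrent_displacement y : ~ periodic_points f y -> ~ omega_limit f y y ->
  exists2 e, 0 < e & forall k, (0 < k)%N -> e <= mdist y (iter k f y).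
Proof.
move=> ny nyy.
have [e1 [L [e10 H1]]] : exists e L, 0 < e /\
    forall n, (L <= n)%N -> e <= mdist y (iter n f y).
  apply: contrapT => none; apply: nyy; apply/omega_limitP => e L e0.
  apply: contrapT => nn; apply: none; exists e, L; split => // n Ln.
  by rewrite leNgt; apply/negP => yn; apply: nn; exists n.
have [e2 e20 H2] := nonperiodic_displacement L ny.
exists (Num.min e1 e2); first by rewrite lt_min e10.
move=> k k0; rewrite ge_min; have [Lk|/ltnW kL] := leqP L k.
  by rewrite H1.
by rewrite H2 ?orbT// k0.
Qed.

(** For nearby [u] and [w], equality of [iter i f u] and [iter j f w] forces the
    fiber of this point to be large: it contains [u] and [iter (j - i) f w]. *)
Lemma delayed_images_apart y e I : 0 < e ->
  (forall k, (0 < k <= \max_(i <- I) i)%N -> e <= mdist y (iter k f y)) ->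
  exists2 b, 0 < b & forall i j u w, i \in I -> j \in I -> (i < j)%N ->
    mdist y u < b -> mdist y w < b -> e / 4 <= mdist u (iter (j - i) f w).
Proof.
move=> e0 He; have e4 : 0 < e / 4 by rewrite divr_gt0.
have [b b0 Hb] := iter_mdist_seq hf (iota 0 (\max_(i <- I) i).+1) y e4.
exists (Num.min (e / 4) b); first by rewrite lt_min e4.
move=> i j u w iI jI ij; rewrite !lt_min => /andP[yu _] /andP[_ yw].
have jiM : (j - i <= \max_(i <- I) i)%N.
  by rewrite (leq_trans (leq_subr _ _))// (@leq_bigmax_seq _ I xpredT id).
have yjw : mdist (iter (j - i) f y) (iter (j - i) f w) < e / 4.
  by apply: Hb => //; rewrite mem_iota add0n ltnS.
have := He (j - i)%N; rewrite subn_gt0 ij jiM => /(_ isT).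
have := metric_triangle y u (iter (j - i) f y).
have := metric_triangle u (iter (j - i) f w) (iter (j - i) f y).
rewrite (metric_sym (iter (j - i) f w)); lra.
Qed.

(** A recurrent nonperiodic point [y] is not a limit of points that are
    eventually mapped into the orbit [O] of a periodic point. Otherwise there are
    connected sets [C], fibers over points of [O], joining [O] to points close to
    [y]. At a time [n] at which the orbit of [y] is away from the neighborhood [W]
    of [O], the part of [C] near [y] has an image that reaches from [O] to the
    outside of [W], so that it meets the finite boundary of [W], at a nonperiodic
    point. As [y] is recurrent there are more such times, with bounded
    differences, than points in this boundary, and two of them meet it at the
    same point [e]. But the fibers of [e] shrink, so that [y] almost returns to
    itself after one of finitely many times. *)
Lemma recurrent_off_periodic_basins y a : ~ periodic_points f y ->
  omega_limit f y y -> periodic_points f a ->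
  exists2 b, 0 < b & forall n u, iter n f u = a -> b <= mdist y u.
Proof.
move=> ny /omega_limitP yy [p [p0 pa]]; apply: contrapT => near_y.
pose O := [seq iter i f a | i <- iota 0 p].
have aO n : iter n f a \in O.
  by rewrite (iter_period _ pa); apply: map_f; rewrite mem_iota add0n ltn_mod.
have OO v n : v \in O -> iter n f v \in O.
  by move=> /mapP[i _ ->]; rewrite -iterD.
have Op v : v \in O -> iter p f v = v.
  by move=> /mapP[i _ ->]; rewrite -iterD addnC iterD pa.
have [||r r0 Or] := @seq_uniform_gt0 R _ O (fun v b => b <= mdist y v).
- by move=> v b b' _ b'b; exact: le_trans.
- move=> v vO; exists (mdist y v) => //; rewrite mdist_gt0.
  by apply/eqP => yv; apply: ny; exists p; rewrite yv Op.
have [|W [oW OW Wr [F bW]]] :=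
    @regular_nbhd_seq _ _ hX O _ (open_mdist_gt y (r / 2)).
  by move=> v /Or /= yv; lra.
have clW u : mdist y u < r / 2 -> ~ closure W u.
  move=> yu /closure_mdistP /(_ (r / 2 - mdist y u))[|w /Wr /= yw uw].
    by rewrite subr_gt0.
  by have := metric_triangle y u w; lra.
have [|I [uI sI yI]] := @frequently_uniq
  (fun i => mdist y (iter i f y) < r / 2) (size F).+1.
  by move=> L; apply: yy; rewrite divr_gt0.
have FI : (size F < size I)%N by rewrite sI.
have [e e0 He] := nonperiodic_displacement (\max_(i <- I) i) ny.
have e4 : 0 < e / 4 by rewrite divr_gt0.
have [b1 b10 Hb1] := delayed_images_apart e0 He.
have [|U [oU Uy Ur [G bU]]] := @regular_nbhd _ _ hX y (Num.min r b1).
  by rewrite lt_min r0.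
have {}Ur u : closure U u -> mdist y u < r /\ mdist y u < b1.
  by move=> /Ur; rewrite lt_min => /andP[].
(* the points of the boundary of [U] that fall into [O] have done so at time [J] *)
have [||J HJ] := @seq_uniform_nat _ G
  (fun w J => (exists k, iter k f w \in O) -> forall n, (J <= n)%N -> iter n f w \in O).
- by move=> w l l' ll' H /H{}H n l'n; apply: H; exact: leq_trans l'n.
- move=> w _; have [[k kw]|none] := pselect (exists k, iter k f w \in O).
    by exists k => _ n kn; rewrite -(subnK kn) iterD; exact: OO.
  by exists 0%N => /none.
have [||L HL] := @seq_uniform_nat _ F (fun v L => ~ periodic_points f v ->
    forall n, (L <= n)%N -> small (e / 4) (iter n f @^-1` [set v])).
- by move=> v l l' ll' H /H{}H n l'n; apply: H; exact: leq_trans l'n.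
- move=> v _; have [pv|nv] := pselect (periodic_points f v); first by exists 0%N => /(_ pv).
  by have [L HL] := nonperiodic_fibers_shrink hX hf nv e4; exists L.
have ballI n : (forall i, i \in I -> mdist y (iter (n + i) f y) < r / 2) ->
    exists2 b, 0 < b & forall u, mdist y u < b ->
      forall i, i \in I -> mdist y (iter (n + i) f u) < r / 2.
  move=> yn; have [||b b0 Hb] := @seq_uniform_gt0 R _ I
    (fun i b => forall u, mdist y u < b -> mdist y (iter (n + i) f u) < r / 2).
  - by move=> i b b' _ b'b H u ub'; apply: H; exact: lt_le_trans b'b.
  - move=> i /yn yni.
    have [|b b0 Hb] := @iter_mdist _ _ f hf (n + i) y (r / 2 - mdist y (iter (n + i) f y)).
      by rewrite subr_gt0.
    exists b => // u /Hb; have := metric_triangle y (iter (n + i) f y) (iter (n + i) f u).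
    lra.
  - by exists b => // u ub i /Hb; exact.
have [b2 b20 yb2] := ballI 0%N yI.
have [n] := yy b2 (maxn J L) b20; rewrite geq_max => /andP[Jn Ln] yn.
have [|b3 b30 yb3] := ballI n.
  by move=> i iI; rewrite addnC iterD; exact: yb2.
have [b4 b40 yb4] : exists2 b, 0 < b & forall u, mdist y u < b -> U u.
  exact: ((open_mdistP _).1 oU).
have [m [c [mc yc]]] : exists m c, iter m f c = a /\ mdist y c < Num.min b3 b4.
  apply: contrapT => none; apply: near_y; exists (Num.min b3 b4).
    by rewrite lt_min b30.
  by move=> m c mc; rewrite leNgt; apply/negP => yc; apply: none; exists m, c.
move: yc; rewrite lt_min => /andP[/yb3 cI /yb4 Uc].
(* the delay [m * p] is at least [m], and is a period of every point of [O] *)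
pose o := iter (m * p) f c.
have oO : o \in O.
  rewrite /o; have mp : (m <= m * p)%N by rewrite leq_pmulr.
  by rewrite -(subnK mp) iterD mc.
pose C := iter (m * p) f @^-1` [set o].
have cC : connected C by apply: connected_preimage => //; exact: connected1.
have Co : C o by rewrite /C /= periodic_recur// Op.
have crossing i : i \in I -> exists2 v, v \in F &
    ~ periodic_points f v /\ exists2 u, closure U u & iter (n + i) f u = v.
  move=> iI; apply: contrapT => none.
  have nWF v : boundary W v -> periodic_points f v \/ forall u, closure U u -> C u ->
      iter (n + i) f u <> v.
    move=> bv; have [pv|nv] := pselect (periodic_points f v); first by left.
    by right => u Uu Cu uv; apply: none; exists v; [exact: bW|split => //; exists u].
  have nCW u : closure U u -> C u -> ~ boundary W (iter (n + i) f u).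
    move=> Uu Cu bu; have [[q [q0 qv]]|/(_ u Uu Cu)//] := nWF _ bu.
    have : iter (n + i) f u \in O.
      rewrite -(periodic_recur (m * p) qv).
      rewrite -(subnK (leq_pmulr (m * p) q0)) iterD; apply: (OO).
      by rewrite -iterD addnC iterD (Cu : _ = o); exact: OO.
    by move=> /OW Wu; move: bu; rewrite open_boundaryE// => -[].
  have : C `<=` U `&` (iter (n + i) f @^-1` ~` closure W).
    apply: (@connected_split _ _ _ _
      (closure U `&` (iter (n + i) f @^-1` ~` W))) => //.
    - apply: openI => //; apply: open_comp; last by rewrite openC; exact: closed_closure.
      by move=> u _; exact: iter_continuous.
    - apply: closedI; first exact: closed_closure.
      apply: closed_comp; last by rewrite closedC.
      by move=> u _; exact: iter_continuous.
    - apply/seteqP; split => u [Cu [Uu nWu]]; split => //.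
        by split; [exact: subset_closure | move=> Wu; apply: nWu; exact: subset_closure].
      have nclW : ~ closure W (iter (n + i) f u).
        move=> Wu; apply: (nCW u Uu Cu).
        by rewrite open_boundaryE.
      split => //; apply: contrapT => nUu; apply: nWu; apply: OW.
      have uG : u \in G.
        have : boundary U u by rewrite open_boundaryE.
        by rewrite bU.
      apply: (HJ u uG); last by rewrite (leq_trans Jn)// leq_addr.
      by exists (m * p)%N; rewrite (Cu : _ = o).
    - by exists c; split => //; split => //=; apply: clW; exact: cI.
  move=> /(_ o Co)[/subset_closure/Ur[yo _] _].
  by have := Or o oO; rewrite leNgt yo.
have [i [j [v [iI jI ij vF [[nv [u Uu uv]] [_ [w Uw wv]]]]]]] :=
  pigeonhole_rel uI FI crossing.
have := Hb1 i j u w iI jI ij (Ur u Uu).2 (Ur w Uw).2.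
rewrite leNgt => /negP; apply.
apply: (@HL v vF nv (n + i)%N) => //; first by rewrite (leq_trans Ln)// leq_addr.
by rewrite /= -iterD -addnA subnKC// ltnW.
Qed.

End recurrence.

(** * Images and preimages of small connected sets *)

Section small_connected_sets.
Context {R : realType} {X : metricType R} (hX : regular_curve X).
Context (f : X -> X) (hf : monotone_map f).
Implicit Types (A B C U : set X) (x y z u v w a : X) (e r d b : R) (I : seq nat).

Lemma cuts_hit F d C : cuts F d -> connected C -> ~ small d C ->
  exists2 v, v \in F & C v.
Proof.
move=> cF cC nC; apply: contrapT => none; apply: nC; apply: cF => // v vF Cv.
by apply: none; exists v.
Qed.

(** No point of [F] lies in two late images of a small set near [y], at times
    whose difference is that of two elements of [I]. The order of the quantifiers
    is what makes this useful: the size of [F] bounds the number of exceptional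
    times, so [F] must not depend on [I]. If [y] is not recurrent then its distance
    to its iterates is bounded below, and the finitely many periodic points whose
    fibers are large for this bound are kept out of [F]. If [y] is recurrent, the
    bound depends on [I], but then the fibers of all periodic points stay away
    from [y]. *)
Lemma forward_cutting_set y d : ~ periodic_points f y -> 0 < d ->
  exists2 F : seq X, cuts F d & forall I, exists2 b, 0 < b & exists L,
    forall v, v \in F -> forall n i j u w, (L <= n)%N ->
      i \in I -> j \in I -> (i < j)%N -> mdist y u < b -> mdist y w < b ->
      iter (n + i) f u = v -> iter (n + j) f w <> v.
Proof.
move=> ny d0.
have apart b n i j u w v : mdist u (iter (j - i) f w) >= b -> (i < j)%N ->
    small b (iter (n + i) f @^-1` [set v]) ->
    iter (n + i) f u = v -> iter (n + j) f w <> v.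
  move=> buw ij sv uv wv; have : mdist u (iter (j - i) f w) < b.
    by apply: sv => //=; rewrite -iterD -addnA subnKC// ltnW.
  by rewrite ltNge buw.
have [yy|nyy] := pselect (omega_limit f y y); last first.
  have [e e0 He] := nonrecurrent_displacement ny nyy.
  have e4 : 0 < e / 4 by rewrite divr_gt0.
  have [F cF [L HL]] := cutting_set_small_fibers hX hf d0 e4.
  exists F => // I; have [k /andP[/He//]|b b0 Hb] :=
    @delayed_images_apart _ _ f hf y e I e0.
  exists b => //; exists L => v vF n i j u w Ln iI jI ij yu yw uv.
  apply: (apart (e / 4) _ i _ u) => //; first exact: Hb.
  by apply: HL => //; rewrite (leq_trans Ln)// leq_addr.
have [F cF _] := cutting_set hX [::] d0; exists F => // I.
have [e e0 He] := nonperiodic_displacement (\max_(i <- I) i) ny.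
have e4 : 0 < e / 4 by rewrite divr_gt0.
have [b b0 Hb] := delayed_images_apart hf e0 He.
have [||c c0 [L HL]] := @seq_uniform R _ F (fun v c L => forall n u, (L <= n)%N ->
    mdist y u < c -> iter n f u = v -> small (e / 4) (iter n f @^-1` [set v])).
- move=> v c c' l l' _ c'c ll' H n u l'n uc; apply: H.
    exact: leq_trans l'n.
  exact: lt_le_trans c'c.
- move=> v _; have [pv|nv] := pselect (periodic_points f v).
    have [c c0 Hc] := recurrent_off_periodic_basins hX hf ny yy pv.
    by exists c => //; exists 0%N => n u _ + /Hc; rewrite leNgt => ->.
  have [L HL] := nonperiodic_fibers_shrink hX hf nv e4.
  by exists 1 => //; exists L => n u Ln _ _; exact: HL.
exists (Num.min b c); first by rewrite lt_min b0.
exists L => v vF n i j u w Ln iI jI ij.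
rewrite !lt_min => /andP[yu yuc] /andP[yw _] uv.
apply: (apart (e / 4) _ i _ u) => //; first exact: Hb.
by apply: HL uv => //; rewrite (leq_trans Ln)// leq_addr.
Qed.

(** However long a window of times is, the images of a small connected set near
    [y] are small at all late times in this window but [N]. A point of the
    cutting set that lies in two of these images has two preimages near [y] at
    different times, so its fiber would be large. *)
Lemma forward_window y d : ~ periodic_points f y -> 0 < d ->
  exists N, forall I, uniq I -> (N < size I)%N ->
  exists2 b, 0 < b & exists L, forall B n, connected B ->
    (forall u, B u -> mdist y u < b) -> (L <= n)%N ->
    exists2 i, i \in I & small d (iter (n + i) f @` B).
Proof.
move=> ny d0; have [F cF HF] := forward_cutting_set ny d0.
exists (size F) => I uI FI; have [b b0 [L HL]] := HF I.
exists b => //; exists L => B n cB Bb Ln; apply: contrapT => large.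
have [i iI|i [j [v [iI jI ij vF [[u Bu uv] [w Bw wv]]]]]] :=
  @pigeonhole_rel _ I F (fun i v => (iter (n + i) f @` B) v) uI FI.
  apply: (cuts_hit cF).
    by apply: connected_image => //; exact: iter_continuous.
  by move=> sB; apply: large; exists i.
by apply: (HL v vF n i j u w) => //; exact: Bb.
Qed.

(** For preimages, a point [v] of the cutting set that lies in two of them has two
    points of its orbit near [y], and [y] would almost be periodic. Periodic
    points do not have to be treated separately, and there is no restriction to
    late times. *)
Lemma backward_window y d : ~ periodic_points f y -> 0 < d ->
  exists N, forall I, uniq I -> (N < size I)%N ->
  exists2 b, 0 < b & forall B n, connected B ->
    (forall u, B u -> mdist y u < b) -> (forall i, i \in I -> (i <= n)%N) ->
    exists2 i, i \in I & small d (iter (n - i) f @^-1` B).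
Proof.
move=> ny d0; have [F cF _] := cutting_set hX [::] d0.
exists (size F) => I uI FI.
have [e e0 He] := nonperiodic_displacement (\max_(i <- I) i) ny.
have [b b0 Hb] := delayed_images_apart hf e0 He.
exists b => // B n cB Bb In; apply: contrapT => large.
have [i iI|i [j [v [iI jI ij vF [Bi Bj]]]]] :=
  @pigeonhole_rel _ I F (fun i v => B (iter (n - i) f v)) uI FI.
  apply: (cuts_hit cF (C := iter (n - i) f @^-1` B)).
    exact: connected_preimage.
  by move=> sB; apply: large; exists i.
have := Hb i j _ _ iI jI ij (Bb _ Bi) (Bb _ Bj); rewrite -iterD.
have -> : (j - i + (n - j) = n - i)%N by have := In j jI; lia.
by rewrite mdistxx leNgt divr_gt0.
Qed.

(** If the images of small connected sets near [y] are large at arbitrarily late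
    times then a point [v] of the cutting set belongs to them at infinitely many
    late times, so that [y] is in the [alpha]-limit set of [v]: the fiber of [v]
    after a suitable delay [k] is small and close to [y]. It meets the image [k]
    steps before, and by [forward_window] one of these delayed images is small. *)
Lemma forward_return y d e : ~ periodic_points f y -> 0 < d -> 0 < e ->
  exists2 b, 0 < b & exists L, forall B n, connected B ->
    (forall u, B u -> mdist y u < b) -> (L <= n)%N -> ~ small d (iter n f @` B) ->
    exists2 k, (k <= L)%N & forall u, B u -> mdist y (iter (n - k) f u) < e.
Proof.
move=> ny d0 e0; have e3 : 0 < e / 3 by rewrite divr_gt0.
have [F cF [L0 HL0]] := cutting_set_small_fibers hX hf d0 e3.
have [N HN] := forward_window ny e3.
have [||b b0 [L HL]] := @seq_uniform R _ F (fun v b L => forall B n, connected B ->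
    (forall u, B u -> mdist y u < b) -> (L <= n)%N -> (iter n f @` B) v ->
    exists2 k, (k <= L)%N & forall u, B u -> mdist y (iter (n - k) f u) < e).
- move=> v b b' l l' _ b'b ll' H B n cB Bb' l'n Bv.
  have [||k kl Hk] := H B n cB _ _ Bv.
  + by move=> u /Bb'/lt_le_trans; exact.
  + exact: leq_trans l'n.
  + by exists k => //; exact: leq_trans ll'.
- move=> v vF; have [yv|nyv] := pselect (alpha_limit f v y); last first.
    apply: contrapT => none; apply: nyv; apply/alpha_limitP => b L b0.
    apply: contrapT => nb; apply: none; exists b => //; exists L => B n _ Bb Ln [u Bu uv].
    by exfalso; apply: nb; exists n, u; split => //; exact: Bb.
  have [|I [uI sI HI]] := @frequently_uniq (fun k => (L0 <= k)%N /\
      exists2 u, iter k f u = v & mdist y u < e / 3) N.+1.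
    move=> L; have [k [u [Lk uv yu]]] := (alpha_limitP f v y).1 yv _ (maxn L L0) e3.
    by move: Lk; rewrite geq_max => /andP[Lk L0k]; exists k => //; split => //; exists u.
  pose M := \max_(i <- I) i.
  have IM i : i \in I -> (i <= M)%N by move=> iI; exact: (@leq_bigmax_seq _ I xpredT id).
  have [||b b0 [L HL]] := HN [seq (M - k)%N | k <- I].
  + rewrite map_inj_in_uniq// => i j /IM iM /IM jM; lia.
  + by rewrite size_map sI.
  exists b => //; exists (L + M)%N => B n cB Bb LMn [u Bu uv].
  have [|_ /mapP[k kI ->]] := HL B (n - M)%N cB Bb; first lia.
  have kM := IM k kI.
  have -> : (n - M + (M - k) = n - k)%N by lia.
  move=> sB; exists k; first lia.
  move=> w Bw; have [L0k [x xv yx]] := HI k kI.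
  have xu : mdist x (iter (n - k) f u) < e / 3.
    by apply: (HL0 k v) => //=; rewrite -iterD -uv; congr iter; lia.
  have uw : mdist (iter (n - k) f u) (iter (n - k) f w) < e / 3.
    by apply: sB; [exists u | exists w].
  have := metric_triangle y x (iter (n - k) f w).
  by have := metric_triangle x (iter (n - k) f u) (iter (n - k) f w); lra.
exists b => //; exists L => B n cB Bb Ln large.
have [|v vF Bv] := cuts_hit cF _ large; last exact: HL Bv.
by apply: connected_image => //; exact: iter_continuous.
Qed.

(** As in [forward_return]: [y] is now in the [omega]-limit set of [v], and the
    orbit of [v] near [y] provides the points in the preimages [k] steps before. *)
Lemma backward_return y d e : ~ periodic_points f y -> 0 < d -> 0 < e ->
  exists2 b, 0 < b & exists L, forall B n, connected B ->
    (forall u, B u -> mdist y u < b) -> (L <= n)%N -> ~ small d (iter n f @^-1` B) ->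
    exists2 k, (k <= L)%N & forall u, B (iter (n - k) f u) -> mdist y u < e.
Proof.
move=> ny d0 e0; have e2 : 0 < e / 2 by rewrite divr_gt0.
have [F cF _] := cutting_set hX [::] d0.
have [N HN] := backward_window ny e2.
have [||b b0 [L HL]] := @seq_uniform R _ F (fun v b L => forall B n, connected B ->
    (forall u, B u -> mdist y u < b) -> (L <= n)%N -> B (iter n f v) ->
    exists2 k, (k <= L)%N & forall u, B (iter (n - k) f u) -> mdist y u < e).
- move=> v b b' l l' _ b'b ll' H B n cB Bb' l'n Bv.
  have [||k kl Hk] := H B n cB _ _ Bv.
  + by move=> u /Bb'/lt_le_trans; exact.
  + exact: leq_trans l'n.
  + by exists k => //; exact: leq_trans ll'.
- move=> v vF; have [yv|nyv] := pselect (omega_limit f v y); last first.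
    apply: contrapT => none; apply: nyv; apply/omega_limitP => b L b0.
    apply: contrapT => nb; apply: none; exists b => //; exists L => B n _ Bb Ln Bv.
    by exfalso; apply: nb; exists n => //; exact: Bb.
  have [|I [uI sI HI]] := @frequently_uniq (fun k => mdist y (iter k f v) < e / 2) N.+1.
    by move=> L; exact: (omega_limitP f v y).1.
  pose M := \max_(i <- I) i.
  have IM i : i \in I -> (i <= M)%N by move=> iI; exact: (@leq_bigmax_seq _ I xpredT id).
  have [|b b0 Hb] := HN I uI; first by rewrite sI.
  exists b => //; exists M => B n cB Bb Mn Bv.
  have [i /IM iM|k kI sB] := Hb B n cB Bb; first exact: leq_trans Mn.
  have kM := IM k kI; exists k => // u Bu.
  have uv : mdist (iter k f v) u < e / 2.
    by apply: sB => //=; rewrite -iterD subnK// (leq_trans kM).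
  by have := metric_triangle y (iter k f v) u; have := HI k kI; lra.
exists b => //; exists L => B n cB Bb Ln large.
have [|v vF Bv] := cuts_hit cF _ large; last exact: HL Bv.
exact: connected_preimage.
Qed.

(** At a point that is neither periodic nor recurrent the iterates are
    asymptotically equicontinuous: otherwise [forward_return] makes the point
    recurrent. *)
Lemma nonrecurrent_equicontinuous y d :
  ~ periodic_points f y -> ~ omega_limit f y y -> 0 < d ->
  exists2 b, 0 < b & exists L, forall B n, connected B -> B y ->
    (forall u, B u -> mdist y u < b) -> (L <= n)%N -> small d (iter n f @` B).
Proof.
move=> ny nyy d0; have [e e0 He] := nonrecurrent_displacement ny nyy.
have [b b0 [L HL]] := forward_return ny d0 e0.
exists b => //; exists L.+1 => B n cB By Bb Ln; apply: contrapT => large.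
have [k kL /(_ y By)] := HL B n cB Bb (ltnW Ln) large.
by rewrite ltNge He// subn_gt0 (leq_ltn_trans kL).
Qed.

End small_connected_sets.

(** * Semicontinuity of the limit sets *)

Section semicontinuity.
Context {R : realType} {X : metricType R} (hX : regular_curve X).
Context (f : X -> X) (hf : monotone_map f).
Implicit Types (A B C U : set X) (x y z u v w a : X) (e r d b : R) (I : seq nat).

Let cX : compact [set: X] := regular_curve_compact hX.

Lemma omega_limit_closed x z : (forall e, 0 < e ->
  exists2 w, omega_limit f x w & mdist z w < e) -> omega_limit f x z.
Proof.
move=> xz; apply/omega_limitP => e L e0.
have [|w /omega_limitP xw zw] := xz (e / 2); first by rewrite divr_gt0.
have [|n Ln wn] := xw (e / 2) L; first by rewrite divr_gt0.
by exists n => //; have := metric_triangle z w (iter n f x); lra.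
Qed.

Lemma alpha_limit_closed x z : (forall e, 0 < e ->
  exists2 w, alpha_limit f x w & mdist z w < e) -> alpha_limit f x z.
Proof.
move=> xz; apply/cluster_setP/cluster_set_closed => e /xz[w xw zw].
by exists w => //; exact/(cluster_setP (fun n => iter n f @^-1` [set x])).
Qed.

Lemma omega_limit_attracts x e : 0 < e -> exists L, forall n, (L <= n)%N ->
  exists2 z, omega_limit f x z & mdist z (iter n f x) < e.
Proof.
move=> e0; have [L HL] := cluster_set_attracts cX (fun n => [set iter n f x]) e0.
exists L => n Ln; have [z xz zn] := HL n _ Ln (erefl _); exists z => //.
apply/omega_limitP => r M r0; have [k [_ [Mk -> zk]]] := xz r M r0.
by exists k.
Qed.

Lemma alpha_limit_attracts x e : 0 < e -> exists L, forall n u, (L <= n)%N ->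
  iter n f u = x -> exists2 z, alpha_limit f x z & mdist z u < e.
Proof.
move=> e0; have [L HL] := cluster_set_attracts cX (fun n => iter n f @^-1` [set x]) e0.
exists L => n u Ln nu; have [z xz zu] := HL n u Ln nu; exists z => //.
exact/(cluster_setP (fun n => iter n f @^-1` [set x])).
Qed.

Lemma periodic_recurrent x : periodic_points f x -> omega_limit f x x.
Proof.
move=> [p [p0 px]]; apply/omega_limitP => e L e0.
by exists (L * p)%N; rewrite ?leq_pmulr// periodic_recur// mdistxx.
Qed.

(** By compactness, a failure of upper semicontinuity produces a limit [z] of
    points of [Lim y'] that is not in [Lim y]. *)
Lemma upper_semicontinuous_at (Lim : X -> set X) y :
  (forall z, (forall e, 0 < e -> exists2 w, Lim y w & mdist z w < e) -> Lim y z) ->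
  (forall z, (forall e b, 0 < e -> 0 < b -> exists y' z',
     [/\ mdist y y' < b, Lim y' z' & mdist z z' < e]) -> Lim y z) ->
  forall d, 0 < d -> exists2 b, 0 < b & forall y', mdist y y' < b ->
    forall z, Lim y' z -> exists2 w, Lim y w & mdist z w < d.
Proof.
move=> Lcl Hz d d0; apply: contrapT => none.
pose far z := forall w, Lim y w -> d <= mdist z w.
have [|z Gz] := @cluster_set_neq0 _ _ cX (fun n => [set z | far z /\
    exists2 y', mdist y y' < n.+1%:R^-1 & Lim y' z]).
  move=> L; apply: contrapT => all; apply: none; exists L.+1%:R^-1.
    by rewrite invr_gt0.
  move=> y' yy' z Lz; apply: contrapT => nw; apply: all; exists L, z.
  split => //; split; last by exists y'.
  by move=> w Lw; rewrite leNgt; apply/negP => zw; apply: nw; exists w.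
have /Hz Lz : forall e b, 0 < e -> 0 < b -> exists y' z',
    [/\ mdist y y' < b, Lim y' z' & mdist z z' < e].
  move=> e b e0 b0; have [n [z' [Ln [_ [y' yy' Lz']] zz']]] := Gz e (Num.truncn b^-1) e0.
  exists y', z'; split => //; apply: lt_le_trans yy' _.
  exact: invn_le_truncn.
have [n [z' [_ [/(_ z Lz) + _]]]] := Gz d 0%N d0.
by rewrite metric_sym leNgt => /negP.
Qed.

(** Let [z] be a limit of points of [omega(y')] as [y'] tends to [y]. For [B]
    connected with [y] and [y'] in [B], the orbit of [z] is followed by that of
    [y'], and by [forward_window] the orbit of [y] is close to the latter at most
    times; hence [omega(z)] is part of [omega(y)]. If [z] were not in [omega(y)]
    then it would not be recurrent, and its iterates would be asymptotically
    equicontinuous; but then the orbit of [z] would return to [z] because those of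
    the points [y'] do. *)
Lemma omega_limit_upper y : ~ periodic_points f y -> forall d, 0 < d ->
  exists2 b, 0 < b & forall y', mdist y y' < b ->
    forall z, omega_limit f y' z -> exists2 w, omega_limit f y w & mdist z w < d.
Proof.
move=> ny; apply: upper_semicontinuous_at; first exact: omega_limit_closed.
move=> z Hz; have {}Hz e b : 0 < e -> 0 < b -> exists2 y', mdist y y' < b &
    forall L, exists2 n, (L <= n)%N & mdist z (iter n f y') < e.
  move=> e0 b0; have [||y' [z' [yy' /omega_limitP y'z' zz']]] := Hz (e / 2) b => //.
    by rewrite divr_gt0.
  exists y' => // L; have [|n Ln zn] := y'z' (e / 2) L; first by rewrite divr_gt0.
  by exists n => //; have := metric_triangle z z' (iter n f y'); lra.
have zy : omega_limit f z `<=` omega_limit f y.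
  move=> q /omega_limitP zq; apply: omega_limit_closed => d d0.
  have d4 : 0 < d / 4 by rewrite divr_gt0.
  have [N HN] := forward_window hX hf ny d4.
  have [|I [uI sI qI]] := @frequently_uniq (fun i => mdist q (iter i f z) < d / 4) N.+1.
    by move=> L; exact: zq.
  have [|b b0 [L HL]] := HN I uI; first by rewrite sI.
  have [b' b'0 LC] := locally_connected hX y b0.
  have [e e0 He] := iter_mdist_seq hf I z d4.
  have [M HM] := omega_limit_attracts y d4.
  have [y' /LC[B [cB By By' Bb]] Hy'] := Hz e b' e0 b'0.
  have [n] := Hy' (maxn L M); rewrite geq_max => /andP[Ln Mn] zn.
  have [i iI sB] := HL B n cB Bb Ln.
  have [w yw wn] := HM (n + i)%N (leq_trans Mn (leq_addr _ _)).
  exists w => //.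
  have yy' : mdist (iter (n + i) f y') (iter (n + i) f y) < d / 4.
    by apply: sB; [exists y'|exists y].
  have := He _ zn i iI; rewrite -iterD addnC => zi; have qi := qI i iI.
  have := metric_triangle q (iter i f z) w.
  have := metric_triangle (iter i f z) (iter (n + i) f y') w.
  have := metric_triangle (iter (n + i) f y') (iter (n + i) f y) w.
  rewrite (metric_sym (iter (n + i) f y) w); lra.
apply: contrapT => nyz.
have nzz : ~ omega_limit f z z by move=> /zy.
have nz : ~ periodic_points f z by move=> /periodic_recurrent.
have [e e0 He] := nonrecurrent_displacement nz nzz.
have e2 : 0 < e / 2 by rewrite divr_gt0.
have [b b0 [L HL]] := nonrecurrent_equicontinuous hX hf nz nzz e2.
have [b' b'0 LC] := locally_connected hX z b0.
have [||y' _ Hy'] := Hz (Num.min (e / 2) b') 1 => //; first by rewrite lt_min e2.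
have [n _] := Hy' 0%N; rewrite lt_min => /andP[_ /LC[B [cB Bz Bn Bb]]].
have [m Lm] := Hy' (n + L.+1)%N; rewrite lt_min => /andP[zm _].
have nm : (n <= m)%N by exact: leq_trans (leq_addr _ _) Lm.
have Lmn : (L < m - n)%N by rewrite leq_subRL.
have := HL B (m - n)%N cB Bz Bb (ltnW Lmn) _ _ (imageP _ Bz) (imageP _ Bn).
rewrite -iterD subnK//.
have := He (m - n)%N (leq_ltn_trans (leq0n _) Lmn).
have := metric_triangle z (iter m f y') (iter (m - n) f z).
rewrite (metric_sym (iter m f y')); lra.
Qed.

(** Since [omega(y)] is compact, finitely many iterates of a point close enough
    to [y] come close to all points of [omega(y)]. *)
Lemma omega_limit_tracked y d : 0 < d -> exists2 e, 0 < e &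
  forall z, omega_limit f y z ->
    exists m, forall u, mdist y u < e -> mdist z (iter m f u) < d.
Proof.
move=> d0; have d3 : 0 < d / 3 by rewrite divr_gt0.
apply: (compact_uniform cX (Q := fun z e => omega_limit f y z ->
    exists m, forall u, mdist y u < e -> mdist z (iter m f u) < d)).
  move=> z e e' _ e'e H /H[m Hm]; exists m => u ue'; apply: Hm.
  exact: lt_le_trans e'e.
move=> z; have [yz|nyz] := pselect (omega_limit f y z).
  have [m _ zm] := (omega_limitP f y z).1 yz _ 0%N d3.
  have [e e0 He] := iter_mdist hf m y d3.
  exists (d / 3), e; split => // w zw _; exists m => u /He ymu.
  have := metric_triangle w z (iter m f u).
  have := metric_triangle z (iter m f y) (iter m f u).
  rewrite (metric_sym w z); lra.
have [r r0 Hr] : exists2 r, 0 < r & forall w, mdist z w < r -> ~ omega_limit f y w.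
  apply: contrapT => none; apply: nyz; apply: omega_limit_closed => e e0.
  apply: contrapT => nw; apply: none; exists e => // w zw yw.
  by apply: nw; exists w.
by exists r, 1; split => // w /Hr.
Qed.

(** Either the images of a small connected set containing [y] and [y'] are small,
    so that the two orbits stay together, or [forward_return] takes the orbit
    of [y'] back to [y]; then it follows the orbit of [y] once more. *)
Lemma omega_limit_lower y : ~ periodic_points f y -> forall d, 0 < d ->
  exists2 b, 0 < b & forall y', mdist y y' < b ->
    forall z, omega_limit f y z -> exists2 w, omega_limit f y' w & mdist z w < d.
Proof.
move=> ny d d0; have d4 : 0 < d / 4 by rewrite divr_gt0.
have d2 : 0 < d / 2 by rewrite divr_gt0.
have [e e0 He] := omega_limit_tracked y d2.
have [b b0 [L HL]] := forward_return hX hf ny d4 e0.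
have [b' b'0 LC] := locally_connected hX y b0.
exists b' => // y' /LC[B [cB By By' Bb]] z yz.
have [M HM] := omega_limit_attracts y' d4.
have [n LMn zn] := (omega_limitP f y z).1 yz _ (L + M)%N d4.
have Ln : (L <= n)%N by exact: leq_trans (leq_addr _ _) LMn.
have Mn : (M <= n)%N by exact: leq_trans (leq_addl _ _) LMn.
have [sB|large] := pselect (small (d / 4) (iter n f @` B)).
  have [w y'w wn] := HM n Mn; exists w => //.
  have := sB _ _ (imageP _ By) (imageP _ By').
  have := metric_triangle z (iter n f y) w.
  have := metric_triangle (iter n f y) (iter n f y') w.
  rewrite (metric_sym (iter n f y') w); lra.
have [k kL /(_ y' By') yk] := HL B n cB Bb Ln large.
have [m /(_ _ yk)] := He z yz; rewrite -iterD => zm.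
have Mm : (M <= m + (n - k))%N.
  by apply: leq_trans (leq_addl _ _); rewrite leq_subRL ?(leq_trans kL)//
    (leq_trans _ LMn)// leq_add2r.
have [w y'w wm] := HM _ Mm; exists w => //.
have := metric_triangle z (iter (m + (n - k)) f y') w.
rewrite (metric_sym (iter (m + (n - k)) f y') w); lra.
Qed.

Lemma X_inftyP x n : X_infty f x -> exists u, iter n f u = x.
Proof. by move=> /(_ n I)[u _ ux]; exists u. Qed.

(** The proof of [omega_limit_upper] applies, with one change. That the orbit of
    [z] returns to [z] is now deduced from two points [u] and [v] close to [z] that
    are mapped to [y'] at times [n] and [m], where [n] is less than [m]: the iterate
    [m - n] of [v] lies in the same fiber of [y'] as [u]. This fiber is small, since
    [y'] is not one of the finitely many periodic points with large fibers when it
    is close to the nonperiodic point [y]. *)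
Lemma alpha_limit_upper y : X_infty f y -> ~ periodic_points f y ->
  forall d, 0 < d -> exists2 b, 0 < b & forall y', mdist y y' < b ->
    forall z, alpha_limit f y' z -> exists2 w, alpha_limit f y w & mdist z w < d.
Proof.
move=> Xy ny; apply: upper_semicontinuous_at; first exact: alpha_limit_closed.
move=> z Hz; have {}Hz e b : 0 < e -> 0 < b -> exists2 y', mdist y y' < b &
    forall L, exists n u, [/\ (L <= n)%N, iter n f u = y' & mdist z u < e].
  move=> e0 b0; have [||y' [z' [yy' /alpha_limitP y'z' zz']]] := Hz (e / 2) b => //.
    by rewrite divr_gt0.
  exists y' => // L.
  have [|n [u [Ln nu zu]]] := y'z' (e / 2) L; first by rewrite divr_gt0.
  by exists n, u; split => //; have := metric_triangle z z' u; lra.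
have zy : omega_limit f z `<=` alpha_limit f y.
  move=> q /omega_limitP zq; apply: alpha_limit_closed => d d0.
  have d4 : 0 < d / 4 by rewrite divr_gt0.
  have [N HN] := backward_window hX hf ny d4.
  have [|I [uI sI qI]] := @frequently_uniq (fun i => mdist q (iter i f z) < d / 4) N.+1.
    by move=> L; exact: zq.
  have [|b b0 Hb] := HN I uI; first by rewrite sI.
  have [b' b'0 LC] := locally_connected hX y b0.
  have [e e0 He] := iter_mdist_seq hf I z d4.
  have [M HM] := alpha_limit_attracts y d4.
  have [y' /LC[B [cB By By' Bb]] Hy'] := Hz e b' e0 b'0.
  have [n [u [Mn nu zu]]] := Hy' (M + \max_(i <- I) i)%N.
  have iM i : i \in I -> (M + i <= n)%N.
    move=> iI; apply: leq_trans Mn.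
    by rewrite leq_add2l (@leq_bigmax_seq _ I xpredT id).
  have [i iI sB] : exists2 i, i \in I & small (d / 4) (iter (n - i) f @^-1` B).
    by apply: Hb => // i /iM; apply: leq_trans; exact: leq_addl.
  have i_n : (i <= n)%N by apply: leq_trans (iM i iI); exact: leq_addl.
  have [v vy] := X_inftyP (n - i) Xy.
  have [|w yw wv] := HM (n - i)%N v _ vy.
    by rewrite leq_subRL// addnC iM.
  exists w => //.
  have uv : mdist (iter i f u) v < d / 4.
    by apply: sB => /=; rewrite ?vy// -iterD subnK// nu.
  have zi := He _ zu i iI; have qi := qI i iI.
  have := metric_triangle q (iter i f z) w.
  have := metric_triangle (iter i f z) (iter i f u) w.
  have := metric_triangle (iter i f u) v w.
  rewrite (metric_sym v w); lra.
apply: contrapT => nyz.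
have nzz : ~ omega_limit f z z by move=> /zy.
have nz : ~ periodic_points f z by move=> /periodic_recurrent.
have [e e0 He] := nonrecurrent_displacement nz nzz.
have e4 : 0 < e / 4 by rewrite divr_gt0.
have [b b0 [L HL]] := nonrecurrent_equicontinuous hX hf nz nzz e4.
have [b' b'0 LC] := locally_connected hX z b0.
have [S Sper HS] := fibers_shrink hX hf e4.
have [||c c0 Hc] := @seq_uniform_gt0 R _ S (fun s c => c <= mdist y s).
- by move=> s c c' _ c'c; exact: le_trans.
- move=> s /Sper ps; exists (mdist y s) => //; rewrite mdist_gt0.
  by apply/eqP => ys; apply: ny; rewrite ys.
have [||y' yy' Hy'] := Hz (Num.min (e / 4) b') c => //; first by rewrite lt_min e4.
have [|K HK] := HS y'.
  by apply/negP => /Hc; rewrite leNgt yy'.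
have [n [u [Kn nu]]] := Hy' K; rewrite lt_min => /andP[zu _].
have [m [v [Lm mv]]] := Hy' (n + L.+1)%N.
rewrite lt_min => /andP[_ /LC[B [cB Bz Bv Bb]]].
have nm : (n <= m)%N by exact: leq_trans (leq_addr _ _) Lm.
have Lmn : (L < m - n)%N by rewrite leq_subRL.
have zv := HL B (m - n)%N cB Bz Bb (ltnW Lmn) _ _ (imageP _ Bz) (imageP _ Bv).
have vu : mdist u (iter (m - n) f v) < e / 4.
  by apply: (HK n Kn) => //=; rewrite -iterD subnKC.
have := He (m - n)%N (leq_ltn_trans (leq0n _) Lmn).
have := metric_triangle z u (iter (m - n) f z).
have := metric_triangle u (iter (m - n) f v) (iter (m - n) f z).
rewrite (metric_sym (iter (m - n) f v)); lra.
Qed.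

(** Upper semicontinuity of the fibers of [iter m f] at [y]. *)
Lemma fiber_upper m y z r : (forall w, iter m f w = y -> mdist z w < r) ->
  exists2 e, 0 < e & forall w, mdist y (iter m f w) < e -> mdist z w < r.
Proof.
move=> Hr; apply: contrapT => none.
have [|w Gw] := @cluster_set_neq0 _ _ cX (fun n => [set w |
    mdist y (iter m f w) < n.+1%:R^-1 /\ r <= mdist z w]).
  move=> L; apply: contrapT => all; apply: none; exists L.+1%:R^-1.
    by rewrite invr_gt0.
  move=> w yw; rewrite ltNge; apply/negP => rw; apply: all.
  by exists L, w.
have wy : iter m f w = y.
  apply/esym/mdist_positivity/eqP; rewrite eq_le mdist_ge0 andbT leNgt.
  apply/negP => yw; have e0 : 0 < mdist y (iter m f w) / 2 by rewrite divr_gt0.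
  have [b b0 Hb] := iter_mdist hf m w e0.
  have [n [v [Ln [yv _] wv]]] := Gw b (Num.truncn (mdist y (iter m f w) / 2)^-1) b0.
  have := Hb v wv; suff /(lt_le_trans yv) : n.+1%:R^-1 <= mdist y (iter m f w) / 2.
    have := metric_triangle y (iter m f v) (iter m f w).
    rewrite (metric_sym (iter m f w)); lra.
  exact: invn_le_truncn.
have zw := Hr w wy.
have [|n [v [_ [_ rv] wv]]] := Gw (r - mdist z w) 0%N; first by rewrite subr_gt0.
have := metric_triangle z w v; lra.
Qed.

(** The analogue of [omega_limit_tracked]; the fibers of the nonperiodic point [y]
    shrink, so that a whole fiber is close to [z] as soon as it meets a small
    neighborhood of [z]. *)
Lemma alpha_limit_tracked y d : ~ periodic_points f y -> 0 < d ->
  exists2 e, 0 < e & forall z, alpha_limit f y z ->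
    exists m, forall w, mdist y (iter m f w) < e -> mdist z w < d.
Proof.
move=> ny d0; have d4 : 0 < d / 4 by rewrite divr_gt0.
apply: (compact_uniform cX (Q := fun z e => alpha_limit f y z ->
    exists m, forall w, mdist y (iter m f w) < e -> mdist z w < d)).
  move=> z e e' _ e'e H /H[m Hm]; exists m => u ue'; apply: Hm.
  exact: lt_le_trans e'e.
move=> z; have [yz|nyz] := pselect (alpha_limit f y z).
  have [L HL] := nonperiodic_fibers_shrink hX hf ny d4.
  have [m [u [Lm mu zu]]] := (alpha_limitP f y z).1 yz _ L d4.
  have [|e e0 He] := @fiber_upper m y z (d / 2).
    move=> w mw; have : mdist u w < d / 4 by apply: (HL m Lm).
    have := metric_triangle z u w; lra.
  exists (d / 4), e; split => // z' zz' _; exists m => w /He zw.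
  have := metric_triangle z' z w; rewrite (metric_sym z' z); lra.
have [r r0 Hr] : exists2 r, 0 < r & forall w, mdist z w < r -> ~ alpha_limit f y w.
  apply: contrapT => none; apply: nyz; apply: alpha_limit_closed => e e0.
  apply: contrapT => nw; apply: none; exists e => // w zw yw.
  by apply: nw; exists w.
by exists r, 1; split => // w /Hr.
Qed.

(** The argument of [omega_limit_lower], with [backward_return]. As [y'] is in
    [X_infty f], it has preimages under all iterates, with which the backward
    orbits of [y] can be followed. *)
Lemma alpha_limit_lower y : ~ periodic_points f y -> forall d, 0 < d ->
  exists2 b, 0 < b & forall y', X_infty f y' -> mdist y y' < b ->
    forall z, alpha_limit f y z -> exists2 w, alpha_limit f y' w & mdist z w < d.
Proof.
move=> ny d d0; have d4 : 0 < d / 4 by rewrite divr_gt0.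
have d2 : 0 < d / 2 by rewrite divr_gt0.
have [e e0 He] := alpha_limit_tracked ny d2.
have [b b0 [L HL]] := backward_return hX hf ny d4 e0.
have [b' b'0 LC] := locally_connected hX y b0.
exists b' => // y' Xy' /LC[B [cB By By' Bb]] z yz.
have [M HM] := alpha_limit_attracts y' d4.
have [n [v [LMn nv zv]]] := (alpha_limitP f y z).1 yz _ (L + M)%N d4.
have Ln : (L <= n)%N by exact: leq_trans (leq_addr _ _) LMn.
have Mn : (M <= n)%N by exact: leq_trans (leq_addl _ _) LMn.
have [sB|large] := pselect (small (d / 4) (iter n f @^-1` B)).
  have [u nu] := X_inftyP n Xy'.
  have [w y'w wu] := HM n u Mn nu; exists w => //.
  have vu : mdist v u < d / 4 by apply: sB => /=; rewrite ?nv ?nu.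
  have := metric_triangle z v w.
  have := metric_triangle v u w.
  rewrite (metric_sym u w); lra.
have [k kL Hk] := HL B n cB Bb Ln large.
have [m Hm] := He z yz.
have [u mu] := X_inftyP (n - k + m) Xy'.
have zu : mdist z u < d / 2 by apply/Hm/Hk; rewrite -iterD mu.
have Mm : (M <= n - k + m)%N.
  by apply: leq_trans (leq_addr _ _); rewrite leq_subRL ?(leq_trans kL)//
    (leq_trans _ LMn)// leq_add2r.
have [w y'w wu] := HM _ u Mm mu; exists w => //.
have := metric_triangle z u w; rewrite (metric_sym u w); lra.
Qed.

End semicontinuity.

(** * The Hausdorff metric *)

Lemma hyperspace_continuous_at (R : realType) (X : metricType R)
    (S : topologicalType) (F : S -> hyperspace X) (s : S) :
  (forall d : R, 0 < d -> \forall t \near s,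
     (forall z, hset (F t) z -> exists2 w, hset (F s) w & mdist z w < d) /\
     (forall z, hset (F s) z -> exists2 w, hset (F t) w & mdist z w < d)) ->
  {for s, continuous F}.
Proof.
move=> HF A /nbhs_mdist[e e0 eA]; have e2 : 0 < e / 2 by rewrite divr_gt0.
apply: filterS (HF _ e2) => t [ts st]; apply: eA.
suff : hausdorff_dist (F s) (F t) <= e / 2 by move=> /le_lt_trans; apply; lra.
apply: hausdorff_dist_le => z.
- by move=> /st[w tw /ltW]; apply: le_trans; exact: dist_to_le.
- by move=> /ts[w sw /ltW]; apply: le_trans; exact: dist_to_le.
Qed.

Theorem theorem5p1 (R : realType) (X : metricType R) (hX : regular_curve X)
    (f : X -> X) (hf : monotone_map f) :
  (forall x : X, ~ periodic_points f x ->
     {for x, continuous (omega_map (regular_curve_compact hX) f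
                           : X -> hyperspace X)}) /\
  (forall x : X_infty f, ~ periodic_points f (set_val x) ->
     {for x, continuous (alpha_map (regular_curve_compact hX) f
                           : X_infty f -> hyperspace X)}).
Proof.
split=> x nx; apply: hyperspace_continuous_at => d d0.
  have [b b0 Hb] := omega_limit_upper hX hf nx d0.
  have [c c0 Hc] := omega_limit_lower hX hf nx d0.
  apply/nbhs_mdist; exists (Num.min b c); first by rewrite lt_min b0.
  by move=> t; rewrite lt_min => /andP[tb tc]; split; [exact: Hb | exact: Hc].
have [b b0 Hb] := alpha_limit_upper hX hf (set_valP x) nx d0.
have [c c0 Hc] := alpha_limit_lower hX hf nx d0.
have : nbhs x (set_val @^-1` [set u | mdist (set_val x) u < Num.min b c]).
  apply: (@initial_continuous (X_infty f) X set_val x).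
  by apply/nbhs_mdist; exists (Num.min b c) => //; rewrite lt_min b0.
apply: filterS => t /=; rewrite lt_min => /andP[tb tc]; split; first exact: Hb.
by apply: Hc => //; exact: set_valP.
Qed.
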